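(* For every integer $n\ge0$, $$c_5(5n+4)\equiv0\pmod5,\qquad c_7(7n+5)\equiv0\pmod7,\qquad c_{11}(11n+6)\equiv0\pmod{11}.$$
   Context: For a partition $\lambda=(\lambda_1,\dots,\lambda_s)$ with conjugate $\lambda'$, the hook length of the node in row $k$ and column $j$ of its Ferrers–Young diagram is $h(k,j)=(\lambda_k-k)+(\lambda'_j-j)+1$. A $t$-core partition of $n$ is a partition of $n$ none of whose hook lengths is divisible by $t$, and $c_t(n)$ denotes the number of $t$-core partitions of $n$. *)

(* Defs.v *)
From mathcomp Require Import all_boot all_order all_algebra.

Set Implicit Arguments.
Unset Strict Implicit.
Unset Printing Implicit Defensive.

Import GRing.Theory.

Definition is_partition (n : nat) (la : seq nat) : bool :=
  [&& sorted geq la, all (leq 1) la & sumn la == n].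

Definition conjugate (la : seq nat) : seq nat :=
  mkseq (fun j => count (ltn j) la) (head 0 la).

(* Rows and columns are numbered from 0, so this is h(k + 1, j + 1). It is
   computed in int because a summand such as la_k - k may be negative. *)
Definition hook_length (la : seq nat) (k j : nat) : int :=
  (((nth 0%N la k)%:Z - k.+1%:Z) + ((nth 0%N (conjugate la) j)%:Z - j.+1%:Z)
   + 1)%R.

Definition is_core (t : nat) (la : seq nat) : bool :=
  [forall k : 'I_(size la), forall j : 'I_(nth 0 la k),
     ~~ (t%:Z %| hook_length la k j)%Z].

(* A partition of n has at most n parts, each at most n, so it is a sequence
   of length at most n over 'I_n.+1; see [core_countE]. *)
Definition core_count (t n : nat) : nat :=
  #|[set s : n.-bseq 'I_n.+1 |
      is_partition n (map val s) && is_core t (map val s)]|.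

Lemma partition_bounds n la :
  is_partition n la -> size la <= n /\ all (gtn n.+1) la.
Proof.
case/and3P=> _ + /eqP <-; elim: la => [//|a l IH] /= /andP[a0 /IH[IHs IHa]].
split; first by rewrite -add1n leq_add.
rewrite ltnS leq_addr; apply: sub_all IHa => x /= xl.
by rewrite ltnS (leq_trans _ (leq_addl _ _)).
Qed.

Lemma core_countE t n (l : seq (seq nat)) : uniq l ->
  (forall la, (la \in l) = is_partition n la && is_core t la) ->
  core_count t n = size l.
Proof.
move=> l_uniq lP; pose f (s : n.-bseq 'I_n.+1) := map val s.
have f_inj : injective f by move=> s1 s2 /(inj_map val_inj) /val_inj.
rewrite /core_count cardE -(size_map f); apply/perm_size/uniq_perm => //.
  by rewrite map_inj_uniq // enum_uniq.
move=> la; rewrite lP; apply/mapP/idP => [[s + ->]|laP].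
  by rewrite mem_enum inE.
have [sz bd] := partition_bounds (proj1 (andP laP)).
have szs : size (map (@inord n) la) <= n by rewrite size_map.
have fE : f (Bseq szs) = la.
  rewrite /f /= -map_comp -[RHS]map_id; apply/eq_in_map => x xla /=.
  by rewrite inordK //; apply: (allP bd).
by exists (Bseq szs); rewrite ?mem_enum ?inE -/(f _) fE.
Qed.

(* Main.v *)
Require Import Defs.
From mathcomp Require Import all_boot all_order all_algebra.
From mathcomp Require Import all_fingroup cyclic pgroup sylow zify ring.

Set Implicit Arguments.
Unset Strict Implicit.

Import GRing.Theory Num.Theory.

(** Write the [t]-cores of [n] as the integer vectors [v] of length [t] with
    [sum v_i = 0] and [sum (t v_i^2 + 2 i v_i) = 2 n]: [v_i] is the excess of
    the number of beads on runner [i] of an abacus whose beads are pushed up.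
    For [t = 5, 7, 11] there are exactly [t] cores of [4, 5, 6] respectively
    (all the partitions), and in a suitable cyclic order their vectors are an
    affine basis over the integers of the vectors of cores of [t n + 4],
    [t n + 5], [t n + 6].  In barycentric coordinates [a], with [sum a_i = 1],
    the quadratic condition reads
    [t (sum a_i^2 - sum a_i a_(i+1)) = |la| + (t^2 - 1) / 24], which is
    invariant under cyclic rotation of [a].  A rotation-invariant [a] would
    give [t a_0 = 1], so rotation acts without fixed points on the cores and
    [t] divides their number. *)

(** * Beta-sets of partitions and their hook lengths *)

(* The partition is padded with zeros to [M] parts; [M] should be at least
   the number of parts. *)
Definition beta_set (M : nat) (la : seq nat) : seq nat :=
  mkseq (fun i => nth 0 la i + (M - i.+1)) M.

Lemma nth_nonincr (la : seq nat) i j :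
  sorted geq la -> i <= j -> nth 0 la j <= nth 0 la i.
Proof.
move=> la_sorted le_ij; have [lt_j|ge_j] := ltnP j (size la); last first.
  by rewrite nth_default.
apply: (@sorted_leq_nth _ geq _ _ 0 la la_sorted i j) => //.
- by move=> a b c /= ab bc; apply: leq_trans bc ab.
- by move=> a /=.
- by rewrite inE (leq_ltn_trans le_ij).
Qed.

(** Both sides say that the cell in row [i] and column [j] lies in the diagram, since the rows
    longer than [j] come first. *)
Lemma ltn_count_sorted (la : seq nat) i j :
  sorted geq la -> (i < count (ltn j) la) = (j < nth 0 la i).
Proof.
elim: la i => [|a l IH] i; first by rewrite nth_nil.
move=> al_sorted; have l_sorted := path_sorted al_sorted.
have /= [lt_ja|le_aj] := ltnP j a.
  by case: i => [|i] /=; rewrite ?lt_ja // add1n ltnS IH.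
have l_le k : nth 0 l k <= j.
  exact: leq_trans (@nth_nonincr (a :: l) 0 k.+1 al_sorted (leq0n _)) le_aj.
rewrite add0n IH // ltnNge l_le; apply/esym/negbTE; rewrite -leqNgt.
by case: i.
Qed.

Lemma conjugateE (la : seq nat) j :
  j < nth 0 la 0 -> nth 0 (Defs.conjugate la) j = count (ltn j) la.
Proof. by move=> lt_j; rewrite /Defs.conjugate nth_mkseq -?nth0. Qed.

Lemma size_beta_set M la : size (beta_set M la) = M.
Proof. exact: size_mkseq. Qed.

Lemma nth_beta_set M la i :
  i < M -> nth 0 (beta_set M la) i = nth 0 la i + (M - i.+1).
Proof. by move=> lt_i; rewrite nth_mkseq. Qed.

Lemma beta_setP M la x :
  reflect (exists2 i, i < M & x = nth 0 la i + (M - i.+1))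
          (x \in beta_set M la).
Proof.
apply: (iffP mapP) => [[i]|[i lt_i ->]].
  by rewrite mem_iota => /andP[_ lt_i] ->; exists i.
by exists i; rewrite ?mem_iota.
Qed.

Lemma beta_set_sorted M la : sorted geq la -> sorted gtn (beta_set M la).
Proof.
move=> la_sorted; apply/(sortedP 0) => i; rewrite size_beta_set => lt_i.
rewrite /= !nth_beta_set //; last exact: ltnW.
have := @nth_nonincr la i i.+1 la_sorted (leqnSn i); lia.
Qed.

Lemma gtn_sorted_uniq (s : seq nat) : sorted gtn s -> uniq s.
Proof.
apply: sorted_uniq => [a b c /= ab bc|a /=]; last exact: ltnn.
exact: ltn_trans bc ab.
Qed.

Definition runner_closed (t : nat) (X : seq nat) : Prop :=
  forall x, x + t \in X -> x \in X.

(* The complement of the beta-set consists of the numbers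
   [M + j - la'_j], and the hook length at (k, j) is the difference between
   the k-th beta-number and the j-th number of the complement. *)
Lemma hook_lengthE M la k j :
  sorted geq la -> size la <= M -> j < nth 0 la k ->
  hook_length la k j =
  ((nth 0 (beta_set M la) k)%:Z - (M + j - count (ltn j) la)%N%:Z)%R.
Proof.
move=> la_sorted szM lt_j.
have lt_k : k < size la.
  by rewrite ltnNge; apply: contraL lt_j => ?; rewrite nth_default.
have := count_size (ltn j) la.
rewrite /hook_length conjugateE ?nth_beta_set //; try lia.
exact: leq_trans lt_j (nth_nonincr la_sorted _).
Qed.

Lemma beta_set_compl M la j :
  sorted geq la -> size la <= M ->
  M + j - count (ltn j) la \notin beta_set M la.
Proof.
move=> la_sorted szM; apply/negP => /beta_setP[i lt_i].
have := ltn_count_sorted i j la_sorted; have := count_size (ltn j) la.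
lia.
Qed.

Lemma beta_set_complP M la y :
  sorted geq la -> size la <= M -> y \notin beta_set M la ->
  exists j, y = M + j - count (ltn j) la.
Proof.
move=> la_sorted szM yX; pose i0 := find (geq y) (beta_set M la).
have i0M : i0 <= M by rewrite -[leqRHS](size_beta_set M la) find_size.
have below i : i < i0 -> y < nth 0 la i + (M - i.+1).
  move=> lt_i; have := before_find 0 lt_i.
  by rewrite nth_beta_set /=; [lia | exact: leq_trans lt_i i0M].
have above : i0 < M -> nth 0 la i0 + (M - i0.+1) < y.
  move=> lt_i0; have: has (geq y) (beta_set M la).
    by rewrite has_find size_beta_set.
  move=> /(nth_find 0); rewrite -/i0 nth_beta_set //= leq_eqVlt.
  case/orP=> [/eqP yE|//]; case/negP: yX; apply/beta_setP.
  by exists i0 => //; rewrite yE.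
(* [i0] counts the beta-numbers above [y]. The other [M - i0] lie below [y], so this subtraction is
   not truncated. *)
exists (y + i0 - M); have cnt := ltn_count_sorted _ (y + i0 - M) la_sorted.
have := count_size (ltn (y + i0 - M)) la.
have := cnt i0; have := cnt i0.-1; have := below i0.-1.
case: (ltngtP i0 M) i0M above; lia.
Qed.

(** The hook lengths in row [k] are the differences between the [k]-th beta-number and the smaller
    numbers missing from the beta-set. If one of them is a multiple of [t], closure under
    subtracting [t] fails on the way down; conversely, a failing step is a hook of length [t]. *)
Lemma is_coreP t M la : 0 < t -> sorted geq la -> size la <= M ->
  reflect (runner_closed t (beta_set M la)) (is_core t la).
Proof.
move=> t_gt0 la_sorted szM; apply: (iffP idP) => [core x|closed].
  case/beta_setP=> k lt_k xE; apply/negPn/negP=> xX.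
  have [j xj] := beta_set_complP la_sorted szM xX.
  have cnt := ltn_count_sorted k j la_sorted; have := count_size (ltn j) la.
  move=> cnt_size; have lt_j : j < nth 0 la k by lia.
  have lt_ks : k < size la.
    by rewrite ltnNge; apply: contraL lt_j => ?; rewrite nth_default.
  move/forallP/(_ (Ordinal lt_ks))/forallP/(_ (Ordinal lt_j))/negP: core.
  apply; rewrite /= (@hook_lengthE M) // nth_beta_set // -xE -xj.
  by rewrite PoszD addrAC subrr add0r dvdzz.
apply/forallP=> -[k lt_k]; apply/forallP=> -[j lt_j]; apply/negP => /=.
rewrite (@hook_lengthE M) //; set y := M + j - _.
have yX : y \notin beta_set M la by apply: beta_set_compl.
have lt_kM := leq_trans lt_k szM.
have : nth 0 (beta_set M la) k \in beta_set M la.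
  by rewrite mem_nth // size_beta_set.
have : y < nth 0 (beta_set M la) k.
  have cnt : k < count (ltn j) la by rewrite ltn_count_sorted.
  have := count_size (ltn j) la; rewrite nth_beta_set // /y.
  by move: lt_j => /=; lia.
set x := nth _ _ k => lt_yx xX /dvdzP[q qE].
have [s xE] : exists s, x = y + s * t.
  by case: q qE => q qE; [exists q | exists 0]; nia.
case/negP: yX; elim: s {lt_yx qE} x xE xX => [|s IH] x ->.
  by rewrite addn0.
by rewrite mulSn (addnC t) addnA => /closed; apply: IH.
Qed.

(** * Runners and the abacus *)

(** Cardinalities are compared: [D] contains the initial segment up to each of its elements and is
    contained in the one below each non-element. *)
Lemma mem_down_closed (D : seq nat) x : uniq D ->
  (forall y, y.+1 \in D -> y \in D) -> (x \in D) = (x < size D).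
Proof.
move=> D_uniq closed.
have down a b : a + b \in D -> a \in D.
  by elim: b => [|b IH]; rewrite ?addn0 // addnS => /closed.
have [xD|xD] := boolP (x \in D); apply/esym.
  rewrite -(size_iota 0 x.+1); apply: uniq_leq_size (iota_uniq _ _) _ => y.
  by rewrite mem_iota ltnS => /= /subnKC yx; apply: (@down _ (x - y)); rewrite
    yx.
apply/negbTE; rewrite -leqNgt -(size_iota 0 x); apply: uniq_leq_size => // y yD.
rewrite mem_iota /= ltnNge; apply: contra xD => /subnKC xy.
by apply: (@down _ (y - x)); rewrite xy.
Qed.

Definition runner_size (t : nat) (X : seq nat) (i : nat) : nat :=
  count (fun x => x %% t == i) X.

(** On each runner the quotients by [t] form a down-closed set, hence an initial segment. *)
Lemma mem_runner_closed t X x : 0 < t -> uniq X -> runner_closed t X ->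
  (x \in X) = (x %/ t < runner_size t X (x %% t)).
Proof.
move=> t_gt0 X_uniq closed; set r := x %% t.
pose D := [seq y %/ t | y <- X & y %% t == r].
have memD y : (y \in D) = (y * t + r \in X).
  have modr : r %% t = r by rewrite modn_mod.
  apply/mapP/idP => [[z]|yX].
    by rewrite mem_filter => /andP[/eqP zr zX] ->; rewrite -zr -divn_eq.
  exists (y * t + r); first by rewrite mem_filter modnMDl modr eqxx.
  by rewrite divnMDl // divn_small ?addn0 // ltn_pmod.
have -> : runner_size t X r = size D by rewrite size_map size_filter.
rewrite -mem_down_closed ?memD -?divn_eq //.
  rewrite map_inj_in_uniq ?filter_uniq // => a b.
  rewrite !mem_filter => /andP[/eqP ar _] /andP[/eqP br _] eq_ab.
  by rewrite (divn_eq a t) (divn_eq b t) eq_ab ar br.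
by move=> y; rewrite !memD mulSn -addnA addnC => /closed.
Qed.

(** The abacus with its beads pushed up, the only form that a runner-closed set can take. *)
Definition abacus (t : nat) (c : nat -> nat) : seq nat :=
  [seq i + t * j | i <- iota 0 t, j <- iota 0 (c i)].

Lemma mem_abacus t c x : 0 < t -> (x \in abacus t c) = (x %/ t < c (x %% t)).
Proof.
move=> t_gt0; apply/allpairsPdep/idP => [[i [j [+ + ->]]]|lt_x].
  rewrite !mem_iota !add0n mulnC => /andP[_ lt_i] /andP[_ lt_j].
  by rewrite addnC divnMDl // modnMDl divn_small // modn_small // addn0.
exists (x %% t), (x %/ t); rewrite !mem_iota !add0n ltn_pmod //=.
by split=> //; rewrite mulnC addnC -divn_eq.
Qed.

Lemma abacus_uniq t c : 0 < t -> uniq (abacus t c).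
Proof.
move=> t_gt0; apply: allpairs_uniq_dep => [|i _|]; rewrite ?iota_uniq //.
move=> [i j] [i' j'] /allpairsPdep[a [b [+ _ [-> ->]]]].
move=> + /allpairsPdep[a' [b' [+ _ [-> ->]]]] /=.
rewrite !mem_iota !add0n /= ![t * _]mulnC => lt_a lt_a' E.
have aE : a = a'.
  by have /(congr1 (modn^~ t)) := E; rewrite ![_ + _ * t]addnC !modnMDl
    !modn_small.
by move: E; rewrite aE => /addnI/eqP; rewrite eqn_pmul2r // => /eqP ->.
Qed.

Lemma perm_abacus t X : 0 < t -> uniq X -> runner_closed t X ->
  perm_eq X (abacus t (runner_size t X)).
Proof.
move=> t_gt0 X_uniq closed; apply: uniq_perm; rewrite ?abacus_uniq // => x.
by rewrite mem_abacus // -mem_runner_closed.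
Qed.

Lemma abacus_closed t c : 0 < t -> runner_closed t (abacus t c).
Proof.
move=> t_gt0 x; rewrite !mem_abacus // modnDr divnDr ?dvdnn // divnn t_gt0.
by rewrite addn1 => /ltnW.
Qed.

Lemma runner_size_abacus t c i : i < t -> runner_size t (abacus t c) i = c i.
Proof.
move=> lt_it; have t_gt0 : 0 < t by apply: leq_ltn_trans lt_it.
rewrite /runner_size -size_filter -[RHS](size_iota 0).
rewrite -(size_map (fun j => j * t + i) (iota 0 (c i))); apply/perm_size.
apply: uniq_perm => [||x]; first by rewrite filter_uniq ?abacus_uniq.
  by rewrite map_inj_uniq ?iota_uniq // => a b /addIn/eqP; rewrite eqn_pmul2r
    // => /eqP.
rewrite mem_filter mem_abacus //; apply/andP/mapP => [[/eqP xi lt_x]|[j]].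
  by exists (x %/ t); rewrite ?mem_iota -?xi // -divn_eq.
rewrite mem_iota => /andP[_ lt_j] ->.
by rewrite modnMDl divnMDl // modn_small // divn_small // addn0.
Qed.

(** * The size of a partition in terms of bead counts *)

Lemma Posz_sum (r : seq nat) (F : nat -> nat) :
  ((\sum_(i <- r) F i)%N : int) = (\sum_(i <- r) (F i)%:Z)%R.
Proof. exact: (big_morph Posz PoszD). Qed.

(** Doubled and stated over [int], which avoids halving and the truncation of [c - 1] at [c = 0]. *)
Lemma arith_series (a d c : nat) :
  ((\sum_(j <- iota 0 c) (a + d * j))%N%:Z * 2 =
   a%:Z * c%:Z * 2 + d%:Z * (c%:Z * (c%:Z - 1)))%R.
Proof.
elim: c => [|c IH]; first by rewrite big_nil; ring.
rewrite -addn1 iotaD big_cat big_seq1 /= PoszD mulrDl IH add0n; nia.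
Qed.

Lemma sum_iota0 n : ((\sum_(i <- iota 0 n) i)%N%:Z * 2 = n%:Z * (n%:Z - 1))%R.
Proof.
rewrite (eq_bigr (fun i => 0 + 1 * i)) ?arith_series; first by ring.
by move=> i _; rewrite mul1n.
Qed.

Lemma sum_nth_default (la : seq nat) M : size la <= M ->
  \sum_(i <- iota 0 M) nth 0 la i = sumn la.
Proof.
elim: la M => [|a l IH] M /=.
  by move=> _; apply: big1 => i _; rewrite nth_nil.
case: M => // M; rewrite ltnS => /IH <-.
by rewrite /= big_cons /= (iotaDl 1 0) big_map.
Qed.

Lemma sum_beta_set M la : size la <= M ->
  \sum_(x <- beta_set M la) x = sumn la + \sum_(i <- iota 0 M) i.
Proof.
move=> szM; rewrite /beta_set big_map big_split /= sum_nth_default //.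
congr addn; rewrite -[in LHS](subn0 M) -/(index_iota 0 M) big_nat_rev /=.
rewrite -[in RHS](subn0 M) -/(index_iota 0 M); apply: eq_big_nat => i.
by lia.
Qed.

Lemma sum_iota_const t (a : int) : (\sum_(i <- iota 0 t) a = t%:Z * a)%R.
Proof.
by rewrite big_const_seq count_predT size_iota iter_addr_0 -mulr_natl natz.
Qed.

(** The first equation fixes the number of beads; the second, doubled to stay integral, records the
    size of the partition. *)
Definition core_vector_sums (t n : nat) (v : nat -> int) : Prop :=
  (\sum_(i <- iota 0 t) (v i) = 0 /\
   \sum_(i <- iota 0 t) (t%:Z * v i ^+ 2 + i%:Z * v i * 2) = n%:Z * 2)%R.

(** The sum of the beta-set is computed twice: as the size of [la] plus [0 + ... + (t * m - 1)], and
    runner by runner as arithmetic series. *)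
Lemma core_vector_sums_beta t m la c : size la <= t * m ->
  perm_eq (beta_set (t * m) la) (abacus t c) ->
  core_vector_sums t (sumn la) (fun i => (c i)%:Z - m%:Z)%R.
Proof.
move=> szM perm.
have sz : (\sum_(i <- iota 0 t) ((c i)%:Z) = t%:Z * m%:Z)%R.
  rewrite -PoszM -(size_beta_set (t * m) la) (perm_size perm).
  rewrite size_allpairs_dep sumnE big_map Posz_sum.
  by apply: eq_bigr => i _; rewrite size_iota.
have wt : (\sum_(i <- iota 0 t) (i%:Z * (c i)%:Z * 2 + t%:Z * ((c i)%:Z * ((c
  i)%:Z - 1))) =
          (sumn la)%:Z * 2 + (t * m)%:Z * ((t * m)%:Z - 1))%R.
  rewrite -sum_iota0 -mulrDl -PoszD -sum_beta_set //.
  rewrite (perm_big _ perm) /= big_allpairs_dep /= Posz_sum mulr_suml.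
  by apply: eq_bigr => i _; rewrite arith_series.
split; first by rewrite big_split /= sum_iota_const sz; ring.
have idx := sum_iota0 t; rewrite Posz_sum in idx.
transitivity (\sum_(i <- iota 0 t) ((i%:Z * (c i)%:Z * 2 + t%:Z * ((c i)%:Z *
  ((c i)%:Z - 1)))
  + (t%:Z - t%:Z * m%:Z * 2) * (c i)%:Z + t%:Z * m%:Z ^+ 2
  + - (m%:Z * 2) * i%:Z))%R.
  by apply: eq_bigr => i _; ring.
have mul2 (x : int) : (- (m%:Z * 2) * x = - m%:Z * (x * 2))%R by ring.
rewrite 3!big_split /= wt -!mulr_sumr sum_iota_const sz mul2 idx PoszM.
ring.
Qed.

(** * The bijection between cores and integer vectors *)

(** With [t * m] beads the empty partition has exactly [m] on every runner, so its vector is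
    zero. *)
Definition core_vector (t m : nat) (la : seq nat) : seq int :=
  mkseq (fun i => (runner_size t (beta_set (t * m) la) i)%:Z - m%:Z)%R t.

Definition is_core_vector (t n : nat) (v : seq int) : Prop :=
  size v = t /\ core_vector_sums t n (nth 0%R v).

Lemma core_vector_sums_ext t n v w : (forall i, i < t -> v i = w i) ->
  core_vector_sums t n v -> core_vector_sums t n w.
Proof.
move=> vw [s0 s1]; split.
  rewrite -[RHS]s0; apply: eq_big_seq => i.
  by rewrite mem_iota => /andP[_ /vw ->].
rewrite -[RHS]s1; apply: eq_big_seq => i.
by rewrite mem_iota => /andP[_ /vw ->].
Qed.

Lemma core_vectorP t m n la : 0 < t -> size la <= t * m ->
  is_partition n la -> is_core t la -> is_core_vector t n (core_vector t m la).
Proof.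
move=> t_gt0 szM /and3P[la_sorted _ /eqP <-] core.
have /(is_coreP t_gt0 la_sorted szM) closed := core.
split; first exact: size_mkseq.
have X_uniq := gtn_sorted_uniq (beta_set_sorted (t * m) la_sorted).
apply: core_vector_sums_ext (core_vector_sums_beta szM (perm_abacus t_gt0
  X_uniq closed)).
by move=> i lt_i; rewrite nth_mkseq.
Qed.

Lemma eq_from_nth_pos (s1 s2 : seq nat) : all (leq 1) s1 -> all (leq 1) s2 ->
  (forall i, nth 0 s1 i = nth 0 s2 i) -> s1 = s2.
Proof.
elim: s1 s2 => [|a s1 IH] [|b s2] //=.
- by move=> _ /andP[b0 _] /(_ 0) /= E; rewrite -E in b0.
- by move=> /andP[a0 _] _ /(_ 0) /= E; rewrite E in a0.
move=> /andP[_ s1P] /andP[_ s2P] E; have /= -> := E 0.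
by rewrite (IH s2) // => i; apply: (E i.+1).
Qed.

(** Membership in a runner-closed set depends only on its runner sizes, so equal vectors give equal
    beta-sets, and these determine the parts. *)
Lemma core_vector_inj t m n la mu : 0 < t ->
  size la <= t * m -> size mu <= t * m ->
  is_partition n la -> is_core t la -> is_partition n mu -> is_core t mu ->
  core_vector t m la = core_vector t m mu -> la = mu.
Proof.
move=> t_gt0 szla szmu /and3P[la_sorted la_pos _] la_core.
move=> /and3P[mu_sorted mu_pos _] mu_core E.
have /(is_coreP t_gt0 la_sorted szla) la_closed := la_core.
have /(is_coreP t_gt0 mu_sorted szmu) mu_closed := mu_core.
have X_sorted := beta_set_sorted (t * m) la_sorted.
have Y_sorted := beta_set_sorted (t * m) mu_sorted.
have eqXY : beta_set (t * m) la = beta_set (t * m) mu.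
  apply: (@irr_sorted_eq _ gtn) => //; try exact: ltnn.
    by move=> a b c /= ab bc; apply: ltn_trans bc ab.
  move=> x; rewrite !(@mem_runner_closed t) ?gtn_sorted_uniq //.
  have lt_r : x %% t < t by rewrite ltn_pmod.
  have := congr1 (fun v => nth 0%R v (x %% t)) E.
  by rewrite !nth_mkseq // => /addIr[->].
apply: eq_from_nth_pos => // i; have [lt_i|ge_i] := ltnP i (t * m).
  have := congr1 (nth 0 ^~ i) eqXY.
  by rewrite !nth_beta_set // => /addIn.
by rewrite !nth_default // (leq_trans _ ge_i).
Qed.

Lemma nth_filter_pos (s : seq nat) i : sorted geq s ->
  nth 0 (filter (leq 1) s) i = nth 0 s i.
Proof.
elim: s i => [//|a s IH] i as_sorted.
have s_sorted := path_sorted as_sorted.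
rewrite [filter _ _]/=; case: ifP => [_|a0].
  by case: i => [//|i] /=; rewrite IH.
rewrite IH //; have a_eq0 : a = 0 by lia.
have := @nth_nonincr _ 0 i as_sorted isT.
have := @nth_nonincr _ 0 i.+1 as_sorted isT.
rewrite /= a_eq0; lia.
Qed.

(** The partition is [X] minus the staircase [M - 1, ..., 0], with zeros removed. *)
Lemma beta_set_onto M X : sorted gtn X -> size X = M ->
  exists la, [/\ sorted geq la, all (leq 1) la, size la <= M & beta_set M la =
    X].
Proof.
move=> X_sorted szX; have X_step i : i.+1 < M -> nth 0 X i.+1 < nth 0 X i.
  by move=> lt_i; apply: (sortedP 0 X_sorted); rewrite szX.
(* [X] dominates the staircase, so the subtraction below is not truncated. *)
have X_ge k : k < M -> k <= nth 0 X (M - k.+1).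
  elim: k => [//|k IH] lt_k; apply: leq_ltn_trans (IH (ltnW lt_k)) _.
  have -> : M - k.+1 = (M - k.+2).+1 by lia.
  by apply: X_step; lia.
pose s := mkseq (fun i => nth 0 X i - (M - i.+1)) M.
have s_sorted : sorted geq s.
  apply/(sortedP 0) => i; rewrite size_mkseq => lt_i; rewrite /= !nth_mkseq //;
    last exact: ltnW.
  have := X_step i lt_i; lia.
exists (filter (leq 1) s); split.
- by apply: sorted_filter s_sorted => a b c /= ab bc; apply: leq_trans bc ab.
- exact: filter_all.
- by rewrite size_filter (leq_trans (count_size _ _)) // size_mkseq.
apply: (@eq_from_nth _ 0); rewrite size_beta_set // => i lt_i.
rewrite nth_beta_set // nth_filter_pos // nth_mkseq // subnK //.
by have := X_ge (M - i.+1); rewrite (_ : M - (M - i.+1).+1 = i); [apply; lia |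
  lia].
Qed.

(** This bounds the [m] that makes every bead count [v i + m] nonnegative. Adding [t] to each term
    of the quadratic sum makes the term nonnegative and at least [- v i]. *)
Lemma core_vector_lower_bound t n v i : core_vector_sums t n v -> i < t ->
  (- v i <= (n * 2 + t * t)%:Z)%R.
Proof.
move=> [_ sumsq] lt_i.
pose T (j : nat) := (t%:Z * v j ^+ 2 + j%:Z * v j * 2 + t%:Z)%R.
have sumT : (\sum_(j <- iota 0 t) T j = (n * 2 + t * t)%:Z)%R.
  rewrite big_split /= sumsq sum_iota_const.
  by rewrite PoszD !PoszM.
have T_ge0 (j : nat) : j < t -> (0 <= T j)%R /\ (- v j <= T j)%R.
  move=> lt_j; have t_gt0 : (0 < 4 * t%:Z)%R by lia.
  (* Completing the square, [4 t T_j = (2 t v_j + 2 j)^2 + 4 (t^2 - j^2)] and [4 t (T_j + v_j) = (2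
     t v_j + 2 j + 1)^2 + 4 t^2 - (2 j + 1)^2], where [j < t]. *)
  split; rewrite -(ler_pM2l t_gt0) /T.
    have : (0 <= (2 * t%:Z * v j + 2 * j%:Z) ^+ 2)%R by exact: sqr_ge0.
    nia.
  have : (0 <= (2 * t%:Z * v j + 2 * j%:Z + 1) ^+ 2)%R by exact: sqr_ge0.
  nia.
rewrite -sumT (bigD1_seq i) ?iota_uniq ?mem_iota //=.
rewrite -[leLHS]addr0 lerD ?(T_ge0 i lt_i).2 //.
rewrite big_seq_cond; apply: sumr_ge0 => j /andP[].
by rewrite mem_iota => /andP[_ /T_ge0[]].
Qed.

Lemma core_vector_onto t m n v : 0 < t -> n * 2 + t * t <= m ->
  is_core_vector t n v ->
  exists la, [/\ is_partition n la, is_core t la & core_vector t m la = v].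
Proof.
move=> t_gt0 m_big [szv sums].
(* By the lower bound [v_i + m] is nonnegative for [i < t], so [absz] does not alter it. *)
pose c i := absz (nth 0%R v i + m%:Z)%R.
have cE i : i < t -> ((c i)%:Z = nth 0%R v i + m%:Z)%R.
  by move=> lt_i; have := core_vector_lower_bound sums lt_i; rewrite /c; lia.
pose X := sort geq (abacus t c).
have geq_tr : transitive geq by move=> a b d /= ab bd; apply: leq_trans bd ab.
have X_sorted : sorted gtn X.
  rewrite gtn_sorted_uniq_geq sort_uniq abacus_uniq //=.
  by apply: sort_sorted => a b; apply: leq_total.
have szX : size X = t * m.
  rewrite size_sort size_allpairs_dep sumnE big_map; apply/eqP.
  rewrite -eqz_nat Posz_sum; apply/eqP.
  transitivity (\sum_(i <- iota 0 t) (nth 0%R v i + m%:Z))%R.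
    by apply: eq_big_seq => i; rewrite mem_iota size_iota => /andP[_ /cE].
  rewrite big_split /= sums.1 sum_iota_const.
  by rewrite add0r.
have [la [la_sorted la_pos szla betaE]] := beta_set_onto X_sorted szX.
have perm : perm_eq (beta_set (t * m) la) (abacus t c).
  by rewrite betaE perm_sort.
have [_ sums_la] := core_vector_sums_beta szla perm.
have sumn_la : sumn la = n.
  have sums' : core_vector_sums t n (fun i => (c i)%:Z - m%:Z)%R.
    by apply: core_vector_sums_ext sums => i lt_i; rewrite cE // addrK.
  by move: sums'.2; rewrite sums_la; lia.
exists la; split.
- by rewrite /is_partition la_sorted la_pos sumn_la eqxx.
- apply/(is_coreP t_gt0 la_sorted szla) => x.
  by rewrite !(perm_mem perm); apply: abacus_closed.
apply: (@eq_from_nth _ 0%R); rewrite size_mkseq // => i lt_i.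
rewrite nth_mkseq // /runner_size (seq.permP perm) -/(runner_size _ _ i).
by rewrite runner_size_abacus // cE // addrK.
Qed.

Lemma core_count_vectors t n : 0 < t ->
  exists2 l : seq (seq int), uniq l /\ size l = core_count t n &
    forall v, v \in l <-> is_core_vector t n v.
Proof.
(* One [m] serves both directions: partitions of [n] have at most [t * m] parts, and bead counts
   stay nonnegative. *)
move=> t_gt0; pose m := n * 2 + t * t.
have n_le : n <= t * m by rewrite /m; nia.
pose S := [set s : n.-bseq 'I_n.+1 |
           is_partition n (map val s) && is_core t (map val s)].
pose f (s : n.-bseq 'I_n.+1) := core_vector t m (map val s).
have sz (s : n.-bseq 'I_n.+1) : size (map val s) <= t * m.
  by rewrite size_map (leq_trans (size_bseq s)).
exists (map f (enum S)).
  rewrite size_map -cardE map_inj_in_uniq ?enum_uniq //.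
  move=> s1 s2; rewrite !mem_enum !inE => /andP[p1 c1] /andP[p2 c2].
  move=> /(core_vector_inj t_gt0 (sz s1) (sz s2) p1 c1 p2 c2).
  by move=> /(inj_map val_inj) /val_inj.
move=> v; split.
  by case/mapP=> s; rewrite mem_enum inE => /andP[p c] ->; apply: core_vectorP.
case/(core_vector_onto t_gt0 (leqnn m)) => la [p c <-].
have [sz_la bd] := partition_bounds p.
have szs : size (map (@inord n) la) <= n by rewrite size_map.
have laE : map val (Bseq szs) = la.
  rewrite /= -map_comp -[RHS]map_id; apply/eq_in_map => x xla /=.
  by rewrite inordK //; apply: (allP bd).
by apply/mapP; exists (Bseq szs); rewrite ?mem_enum ?inE /f laE ?p.
Qed.

(** * Counting modulo a prime by cyclic rotation *)

Lemma rot1_fixed (T : Type) (x : T) s :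
  rot 1 (x :: s) = x :: s -> s = nseq (size s) x.
Proof.
by rewrite rot1_cons; elim: s => [//|y s IH] [-> /IH {1}->].
Qed.

Lemma iter_rot1 (T : Type) (s : seq T) k : k <= size s ->
  iter k (rot 1) s = rot k s.
Proof.
elim: k => [|k IH] lt_k; first by rewrite rot0.
by rewrite iterS IH ?(ltnW lt_k) // -rotD ?add1n.
Qed.

(** Under a [p]-group action the cardinality is congruent modulo [p] to the number of fixed points,
    here zero. *)
Lemma prime_dvdn_rot1_closed p (l : seq (seq int)) : prime p -> uniq l ->
  (forall a, a \in l -> size a = p /\ (\sum_(x <- a) x = 1)%R) ->
  (forall a, a \in l -> rot 1 a \in l) -> p %| size l.
Proof.
move=> p_prime l_uniq l_good l_rot.
pose f (x : seq_sub l) := SeqSub (l_rot _ (valP x)).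
have f_inj : injective f by move=> x y /(congr1 val) /rot_inj /val_inj.
have f_iter x k : val (iter k f x) = iter k (rot 1) (val x).
  by elim: k => //= k ->.
have iter_p a : a \in l -> iter p (rot 1) a = a.
  by move=> /l_good[sz _]; rewrite iter_rot1 ?sz // -sz rot_size.
pose s := perm f_inj.
have s_order : #[s]%g %| p.
  rewrite order_dvdn; apply/eqP/permP => x; rewrite permX perm1.
  rewrite (eq_iter (permE f_inj)); apply: val_inj.
  by rewrite f_iter iter_p // (valP x).
have s_pgroup : (p.-group <[s]>)%g by apply: pnat_dvd s_order (pnat_id p_prime).
have s_acts : [acts <[s]>, on [set: seq_sub l] | 'P]%g.
  by apply/subsetP=> g _; rewrite !inE; apply/subsetP => x; rewrite !inE.
have := pgroup_fix_mod s_pgroup s_acts; rewrite cardsT card_seq_sub //.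
suff -> : ('Fix_([set: seq_sub l] | 'P)(<[s]>) = set0)%g.
  by rewrite cards0 mod0n => /eqP.
apply/setP => x; rewrite afix_cycle ?inE //= sub1set inE; apply/negP => /eqP.
rewrite apermE permE => /(congr1 val) /=.
have [/=] := l_good _ (valP x); case: (ssval x) => [|a0 a] sz.
  by rewrite -sz in p_prime.
(* A fixed sequence is constant, so its sum is [p] times [a0], which cannot be 1. *)
move=> + rot_a; have aE := rot1_fixed rot_a; rewrite aE big_cons big_nseq
  iter_addr_0.
rewrite -mulrS -[(size a).+1]/(size (a0 :: a)) sz => /(congr1 absz).
rewrite -[(a0 *+ p)%R]mulr_natl abszM natz /= => /eqP.
by rewrite muln_eq1 => /andP[/eqP p1 _]; rewrite p1 in p_prime.
Qed.

(** The count is transported from core vectors to their preimages under [G], on which the rotation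
    acts. *)
Lemma dvdn_core_count p n (G : seq int -> seq int) : prime p ->
  (forall v, is_core_vector p n v ->
     exists2 a : seq int, size a = p /\ (\sum_(x <- a) x = 1)%R & G a = v) ->
  (forall a : seq int, size a = p -> (\sum_(x <- a) x = 1)%R ->
     is_core_vector p n (G a) -> is_core_vector p n (G (rot 1 a))) ->
  (forall a b : seq int, size a = p -> size b = p -> (\sum_(x <- a) x = 1)%R ->
     (\sum_(x <- b) x = 1)%R -> G a = G b -> a = b) ->
  core_count p n = 0 %[mod p].
Proof.
move=> p_prime G_onto G_rot G_inj; apply/eqP; rewrite mod0n -/(dvdn _ _).
have [l [l_uniq <-] lP] := core_count_vectors n (prime_gt0 p_prime).
(* Preimages are chosen one by one along [l], one for each core vector. *)
have [l' l'P l'E] : exists2 l' : seq (seq int),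
    forall a, a \in l' -> size a = p /\ (\sum_(x <- a) x = 1)%R & map G l' = l.
  have: forall v, v \in l -> is_core_vector p n v by move=> v /lP.
  elim: l {l_uniq lP} => [|v l IH] lP; first by exists [::].
  have [l' l'P l'E] : _ := IH (fun w wl => lP w (@mem_behead _ (v :: l) w wl)).
  have [a aP aE] := G_onto v (lP v (mem_head v l)).
  exists (a :: l'); last by rewrite /= aE l'E.
  by move=> b; rewrite inE => /orP[/eqP ->|/l'P].
rewrite -l'E size_map; apply: prime_dvdn_rot1_closed => //.
  by apply: (@map_uniq _ _ G); rewrite l'E.
move=> a al'; have [sz sum1] := l'P a al'.
have : G (rot 1 a) \in map G l'.
  by rewrite l'E; apply/lP/G_rot => //; apply/lP; rewrite -l'E map_f.
case/mapP=> b bl' E; have [szb sumb] := l'P b bl'.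
(* [rot 1 a] and [b] have the same image, so injectivity puts the rotation itself in [l']. *)
rewrite (G_inj (rot 1 a) b) // ?size_rot //.
by rewrite (perm_big _ (permEl (perm_rot 1 a))).
Qed.

(** * A linear congruence satisfied by core vectors *)

Lemma sqrz_parity (x : int) : exists y : int, (x ^+ 2 = x + 2 * y)%R.
Proof.
have [z [->|->]] : exists z : int, (x = 2 * z \/ x = 2 * z + 1)%R.
- by exists (x %/ 2)%Z; lia.
- by exists (2 * z ^+ 2 - z)%R; ring.
by exists (2 * z ^+ 2 + z)%R; ring.
Qed.

(** Since [x^2] and [x] have the same parity and the [v i] sum to 0, the sum of squares is even and
    the quadratic equation can be halved. The resulting congruence makes the barycentric coordinates
    integral. *)
Lemma core_vector_moment t n v : core_vector_sums t n v ->
  exists k : int, (\sum_(i <- iota 0 t) i%:Z * v i = n%:Z + t%:Z * k)%R.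
Proof.
move=> [sum0]; rewrite big_split /= -mulr_sumr -mulr_suml.
have [k ->] : exists k : int, (\sum_(i <- iota 0 t) v i ^+ 2 = 2 * k)%R.
  have [k sumk] : exists k : int,
      (\sum_(i <- iota 0 t) v i ^+ 2 = \sum_(i <- iota 0 t) v i + 2 * k)%R.
    elim: (iota 0 t) {sum0} => [|i s [k IH]].
      by exists 0%R; rewrite !big_nil.
    have [y yE] := sqrz_parity (v i).
    by exists (y + k)%R; rewrite !big_cons IH yE; ring.
  by exists k; rewrite sumk sum0 add0r.
by move=> sumsq; exists (- k)%R; move: (bigop.body _ _ _) sumsq => B; lia.
Qed.

(** * Barycentric coordinates for 5, 7 and 11 *)

(* The core vector with barycentric coordinates [a]: the [j]-th column of this
   linear map is the vector of the [j]-th partition of 4 in the order 4, 31,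
   211, 1111, 22. *)
Definition core_coords5 (a : seq int) : seq int :=
  if a is [:: a0; a1; a2; a3; a4] then
    [:: a3 + a4; a2 + a4 - a3; a1 - a2; a0 - a1 - a4; - a0 - a4]%R
  else [::].

(** The three goals are integral inversion, where the residue 4 enters, rotation invariance and
    injectivity. *)
Lemma core_count5_mod n : core_count 5 (5 * n + 4) = 0 %[mod 5].
Proof.
apply: (@dvdn_core_count _ _ core_coords5) => //.
- move=> v [sz_v sums]; have [j] := core_vector_moment sums.
  case: v sz_v {sums}sums.1 => [|v0 [|v1 [|v2 [|v3 [|v4 [|? ?]]]]]] //= _.
  rewrite !big_cons !big_nil /= => sum0 jE.
  (* The moment is [5 n + 4 + 5 j], whence [k = n + j]. *)
  have [k kE] : exists k : int,
      (v1 + 2 * v2 + 3 * v3 + 4 * v4 = 4 + 5 * k)%R.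
    by exists (n%:Z + j)%R; lia.
  (* The inverse of [core_coords5], after [v0] and [v1] are eliminated by
     [sum0] and [kE]. *)
  exists [:: 1 + k - v4; 2 + 2 * k - v3 - v4; 2 + 2 * k - v2 - v3 - v4;
           v2 + 2 * v3 + 3 * v4 - 3 - 4 * k; - 1 - k]%R.
    by rewrite !big_cons big_nil; split=> //; lia.
  by rewrite /=; congr [:: _; _; _; _; _]; lia.
- case=> [|a0 [|a1 [|a2 [|a3 [|a4 [|? ?]]]]]] // _.
  rewrite !big_cons big_nil => sum1 [_ []]; rewrite /= !big_cons !big_nil /=.
  (* With [a0] eliminated, the quadratic sums of [a] and of its rotation are the same polynomial in
     the other coordinates. *)
  have -> : (a0 = 1 - (a1 + a2 + a3 + a4))%R by lia.
  move=> _ sumsq; split=> //; split; rewrite /= !big_cons !big_nil /=; first by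
    ring.
  by rewrite -sumsq; ring.
case=> [|a0 [|a1 [|a2 [|a3 [|a4 [|? ?]]]]]] //.
case=> [|b0 [|b1 [|b2 [|b3 [|b4 [|? ?]]]]]] // _ _.
(* Images have coordinate sum 0, so the five equations have rank 4; [sum_a] and [sum_b] supply the
   missing one. *)
rewrite !big_cons !big_nil => sum_a sum_b [e0 e1 e2 e3 e4].
by congr [:: _; _; _; _; _]; lia.
Qed.

(* Partitions of 5 in the order 5, 311, 11111, 32, 2111, 41, 221. *)
Definition core_coords7 (a : seq int) : seq int :=
  if a is [:: a0; a1; a2; a3; a4; a5; a6] then
    [:: a2 + a3 + a6; a4 + a6; a1 + a3 - a2; a5 - a4; a0 - a1 - a6;
        - a3 - a5; - a0 - a3 - a6]%R
  else [::].

Lemma core_count7_mod n : core_count 7 (7 * n + 5) = 0 %[mod 7].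
Proof.
apply: (@dvdn_core_count _ _ core_coords7) => //.
- move=> v [sz_v sums]; have [j] := core_vector_moment sums.
  case: v sz_v {sums}sums.1 => [|v0 [|v1 [|v2 [|v3 [|v4 [|v5 [|v6 [|? ?]]]]]]]]
    //= _.
  rewrite !big_cons !big_nil /= => sum0 jE.
  have [k kE] : exists k : int,
      (v1 + 2 * v2 + 3 * v3 + 4 * v4 + 5 * v5 + 6 * v6 = 5 + 7 * k)%R.
    by exists (n%:Z + j)%R; lia.
  (* The inverse of [core_coords7], in terms of [k] and [v2] to [v6], after elimination of [v0] and
     [v1]. *)
  exists [:: 1 + k - v6; v2 + v3 + v4 + 2 * v5 + 2 * v6 - 1 - 2 * k;
           v2 + 2 * v3 + 3 * v4 + 4 * v5 + 5 * v6 - 4 - 6 * k;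
           v2 + v3 + 2 * v4 + 2 * v5 + 3 * v6 - 3 - 4 * k;
           3 + 4 * k - v2 - 2 * v3 - 2 * v4 - 3 * v5 - 3 * v6;
           3 + 4 * k - v2 - v3 - 2 * v4 - 3 * v5 - 3 * v6;
           2 + 3 * k - v2 - v3 - 2 * v4 - 2 * v5 - 3 * v6]%R.
    by rewrite !big_cons big_nil; split=> //; lia.
  by rewrite /=; congr [:: _; _; _; _; _; _; _]; lia.
- case=> [|a0 [|a1 [|a2 [|a3 [|a4 [|a5 [|a6 [|? ?]]]]]]]] // _.
  rewrite !big_cons big_nil => sum1 [_ []]; rewrite /= !big_cons !big_nil /=.
  have -> : (a0 = 1 - (a1 + a2 + a3 + a4 + a5 + a6))%R by lia.
  move=> _ sumsq; split=> //; split; rewrite /= !big_cons !big_nil /=; first by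
    ring.
  by rewrite -sumsq; ring.
case=> [|a0 [|a1 [|a2 [|a3 [|a4 [|a5 [|a6 [|? ?]]]]]]]] //.
case=> [|b0 [|b1 [|b2 [|b3 [|b4 [|b5 [|b6 [|? ?]]]]]]]] // _ _.
rewrite !big_cons !big_nil => sum_a sum_b [e0 e1 e2 e3 e4 e5 e6].
by congr [:: _; _; _; _; _; _; _]; lia.
Qed.

(* Partitions of 6 in the order 6, 222, 3111, 42, 21111, 321, 51, 2211, 411, 33,
   111111. *)
Definition core_coords11 (a : seq int) : seq int :=
  if a is [:: a0; a1; a2; a3; a4; a5; a6; a7; a8; a9; a10] then
    [:: a1 + a3 + a5 + a7 + a10; a1 + a4 + a7 + a9; a2 + a5 + a9; a3 + a8;
        a6; a0 - a10; - a4; - a2 - a7; - a1 - a5 - a8; - a1 - a3 - a6 - a9;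
        - a0 - a3 - a5 - a7 - a9]%R
  else [::].

Lemma core_count11_mod n : core_count 11 (11 * n + 6) = 0 %[mod 11].
Proof.
apply: (@dvdn_core_count _ _ core_coords11) => //.
- move=> v [sz_v sums]; have [j] := core_vector_moment sums.
  case: v sz_v {sums}sums.1 => [|v0 [|v1 [|v2 [|v3 [|v4 [|v5 [|v6 [|v7 [|v8
    [|v9 [|v10 [|? ?]]]]]]]]]]]] //= _.
  rewrite !big_cons !big_nil /= => sum0 jE.
  have [k kE] : exists k : int,
      (v1 + 2 * v2 + 3 * v3 + 4 * v4 + 5 * v5 + 6 * v6 + 7 * v7 + 8 * v8 + 9 *
        v9 + 10 * v10 = 6 + 11 * k)%R.
    by exists (n%:Z + j)%R; lia.
  (* The inverse of [core_coords11], with [v0] and [v1] again eliminated by [sum0] and [kE]. *)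
  exists [:: v5 + v6 + v7 + v8 + v9 + v10 - k;
           v5 + v6 + v7 + v8 + v9 + 2 * v10 - 1 - 2 * k;
           v2 + v3 + v4 + 2 * v5 + 2 * v6 + 2 * v7 + 3 * v8 + 3 * v9 + 4 * v10
             - 2 - 4 * k;
           v2 + 2 * v3 + 2 * v4 + 3 * v5 + 3 * v6 + 4 * v7 + 5 * v8 + 5 * v9 +
             6 * v10 - 4 - 7 * k;
           - v6;
           v2 + v3 + 2 * v4 + 2 * v5 + 2 * v6 + 3 * v7 + 3 * v8 + 4 * v9 + 4 *
             v10 - 3 - 5 * k;
           v4;
           2 + 4 * k - v2 - v3 - v4 - 2 * v5 - 2 * v6 - 3 * v7 - 3 * v8 - 3 *
             v9 - 4 * v10;
           4 + 7 * k - v2 - v3 - 2 * v4 - 3 * v5 - 3 * v6 - 4 * v7 - 5 * v8 - 5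
             * v9 - 6 * v10;
           5 + 9 * k - v2 - 2 * v3 - 3 * v4 - 4 * v5 - 4 * v6 - 5 * v7 - 6 * v8
             - 7 * v9 - 8 * v10;
           v6 + v7 + v8 + v9 + v10 - k]%R.
    by rewrite !big_cons big_nil; split=> //; lia.
  by rewrite /=; congr [:: _; _; _; _; _; _; _; _; _; _; _]; lia.
- case=> [|a0 [|a1 [|a2 [|a3 [|a4 [|a5 [|a6 [|a7 [|a8 [|a9 [|a10 [|?
    ?]]]]]]]]]]]] // _.
  rewrite !big_cons big_nil => sum1 [_ []]; rewrite /= !big_cons !big_nil /=.
  have -> : (a0 = 1 - (a1 + a2 + a3 + a4 + a5 + a6 + a7 + a8 + a9 + a10))%R by
    lia.
  move=> _ sumsq; split=> //; split; rewrite /= !big_cons !big_nil /=; first by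
    ring.
  by rewrite -sumsq; ring.
case=> [|a0 [|a1 [|a2 [|a3 [|a4 [|a5 [|a6 [|a7 [|a8 [|a9 [|a10 [|?
  ?]]]]]]]]]]]] //.
case=> [|b0 [|b1 [|b2 [|b3 [|b4 [|b5 [|b6 [|b7 [|b8 [|b9 [|b10 [|?
  ?]]]]]]]]]]]] // _ _.
rewrite !big_cons !big_nil => sum_a sum_b [e0 e1 e2 e3 e4 e5 e6 e7 e8 e9 e10].
by congr [:: _; _; _; _; _; _; _; _; _; _; _]; lia.
Qed.

Theorem corollary3p10 (n : nat) :
  [/\ core_count 5 (5 * n + 4) = 0 %[mod 5],
      core_count 7 (7 * n + 5) = 0 %[mod 7] &
      core_count 11 (11 * n + 6) = 0 %[mod 11] ].
Proof.
exact: (And3 (core_count5_mod n) (core_count7_mod n) (core_count11_mod n)).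
Qed.
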